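(* The automorphisms $\mathbf J_{\mathcal F}$ and $U=\sigma_{V_\bullet}$ of $|\mathcal F|$ commute: $\mathbf J_{\mathcal F}U=U\mathbf J_{\mathcal F}$. Hence $\mathbf J_{\partial\mathcal F}U=U\mathbf J_{\partial\mathcal F}$ on $\partial_I\mathcal F$, and for every irrational real $x$ one has $\mathbf J_{\mathbb R}(1/x)=1/\mathbf J_{\mathbb R}(x)$ in $\widehat{\mathbb R}$.
   Context: $\mathrm{PSL}_2(\mathbb Z)=\langle S,L\mid S^2=L^3=1\rangle$, $S(z)=-1/z$, $L(z)=(z-1)/z$. The bipartite Farey tree $\mathcal F$ has edge set $\mathrm{PSL}_2(\mathbb Z)$; its vertices are the left cosets $\{W,WS\}$ (2-valent) and $\{W,WL,WL^2\}$ (3-valent); two distinct vertices are joined by an edge iff they intersect, the edge being the common element. $|\mathcal F|$ is the underlying abstract tree, $I$ the edge labelled by the identity, $V_\bullet$ the set of 3-valent vertices, $v^*=\{I,L,L^2\}$. Tree automorphisms. Elements of $\mathrm{PSL}_2(\mathbb Z)$ are uniquely reduced words alternating between $S$ and one of $L,L^2$. $U=\sigma_{V_\bullet}$ is the automorphism of $|\mathcal F|$ fixing $I$ that shuffles every trivalent vertex: on edges it replaces every $L$ by $L^2$ and every $L^2$ by $L$ in the reduced word. $\mathbf J_{\mathcal F}$ is the automorphism of $|\mathcal F|$ fixing $I$ that shuffles exactly the trivalent vertices at odd distance from $v^*$ (distance in the trivalent tree obtained by forgetting 2-valent vertices): on the reduced word of an edge, if the word does not begin with $S$, it exchanges $L\leftrightarrow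 L^2$ in the 2nd, 4th, 6th, … of the letters $L^{\pm1}$ (where $L^{-1}=L^2$) and leaves the other ones unchanged; if the word begins with $S$, it exchanges $L\leftrightarrow L^2$ in the 1st, 3rd, 5th, … of these letters. Boundary. $\partial_I\mathcal F$ is the set of infinite non-backtracking paths in $\mathcal F$ starting at $I$, i.e. infinite reduced words; writing $0$ for $LS$ and $1$ for $L^2S$, these are the words $a$ or $Sa$ with $a\in\{0,1\}^\omega$. $\mathbf J_{\partial\mathcal F}$ and $U$ are the induced homeomorphisms: $U(a)=\lnot a$, $U(Sa)=S\lnot a$ (term-wise negation), $\mathbf J_{\partial\mathcal F}(a)=a\oplus\phi$, $\mathbf J_{\partial\mathcal F}(Sa)=S(a\oplus\phi^* )$, with $\phi=(01)^\omega$, $\phi^*=(10)^\omega$, $\oplus$ term-wise exclusive or. Real line. $\widehat{\mathbb R}=\mathbb R\cup\{\infty\}$. For $a=0^{n_0}1^{n_1}0^{n_2}\cdots$ ($n_0\ge0$, $n_i\ge1$ for $i\geq 1$; last exponent $\infty$ if eventually constant) let $\kappa(a)=[n_0,n_1,n_2,\dots]$ (continued fraction, $1/\infty=0$, $[\infty]=\infty$) and $\kappa(Sa)=-1/\kappa(a)$ (with $1/0=\infty$). Every irrational $x$ is $\kappa(w)$ for a unique $w\in\partial_I\mathcal F$, and $\mathbf J_{\mathbb R}:\mathbb R\setminus\mathbb Q\to\widehat{\mathbb R}$ is $\mathbf J_{\mathbb R}(x)=\kappa(\mathbf J_{\partial\mathcal F}(w))$. Conventions $1/0=\infty$, $1/\infty=0$.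 *)

(* Defs.v *)
From HB Require Import structures.
From mathcomp Require Import all_boot all_order all_algebra.
From mathcomp Require Import all_classical all_reals all_analysis.
From mathcomp Require Import zify ring.
Set Implicit Arguments.
Unset Strict Implicit.
Unset Printing Implicit Defensive.
Import Order.TTheory GRing.Theory Num.Theory.
Import numFieldNormedType.Exports.
Local Open Scope ring_scope.
Local Open Scope classical_set_scope.
Local Open Scope quotient_scope.

Record SL2Z := SL2 { slmx :> 'M[int]_2; slP : \det slmx == 1 }.
HB.instance Definition _ := [isSub for slmx].
HB.instance Definition _ := [Choice of SL2Z by <:].

Fact sl_one_subproof : \det (1%:M : 'M[int]_2) == 1.
Proof. by rewrite det1. Qed.
Fact sl_mul_subproof (M N : SL2Z) : \det (M *m N) == 1.
Proof. by rewrite det_mulmx (eqP (slP M)) (eqP (slP N)). Qed.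
Fact sl_inv_subproof (M : SL2Z) : \det (\adj M) == 1.
Proof.
have := congr1 determinant (mul_mx_adj M).
by rewrite det_mulmx (eqP (slP M)) mul1r det1 => ->.
Qed.
Definition sl_one := SL2 sl_one_subproof.
Definition sl_mul (M N : SL2Z) := SL2 (sl_mul_subproof M N).
Definition sl_inv (M : SL2Z) := SL2 (sl_inv_subproof M).

Fact sl_mulA : associative sl_mul.
Proof. by move=> M N P; apply/val_inj; rewrite /= mulmxA. Qed.
Fact sl_mul1 : left_id sl_one sl_mul.
Proof. by move=> M; apply/val_inj; rewrite /= mul1mx. Qed.
Fact sl_mulr1 : right_id sl_one sl_mul.
Proof. by move=> M; apply/val_inj; rewrite /= mulmx1. Qed.
Fact sl_mulV : left_inverse sl_one sl_inv sl_mul.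
Proof. by move=> M; apply/val_inj; rewrite /= mul_adj_mx (eqP (slP M)). Qed.
Fact sl_mulrV : right_inverse sl_one sl_inv sl_mul.
Proof. by move=> M; apply/val_inj; rewrite /= mul_mx_adj (eqP (slP M)). Qed.
HB.instance Definition _ :=
  isGroup.Build SL2Z sl_mulA sl_mul1 sl_mulr1 sl_mulV sl_mulrV.

Definition sl_pm (M N : SL2Z) : bool :=
  (slmx M == slmx N) || (slmx M == - slmx N).
Fact sl_pm_equiv : equiv_class_of sl_pm.
Proof.
rewrite /sl_pm; split=> [M|M N|N M P]; first by rewrite eqxx.
  by rewrite eq_sym [_ == - _]eq_sym eqr_oppLR.
by move=> /orP[]/eqP-> /orP[]/eqP->; rewrite ?opprK ?eqxx ?orbT.
Qed.
Canonical sl_pm_rel := EquivRelPack sl_pm_equiv.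
Canonical sl_pm_enc := defaultEncModRel sl_pm.

(* SL_2(Z) modulo sign: the group of the maps z |-> (a z + b) / (c z + d). *)
Definition PSL2Z := {eq_quot sl_pm}.
HB.instance Definition _ : EqQuotient SL2Z sl_pm PSL2Z := EqQuotient.on PSL2Z.
HB.instance Definition _ := Choice.on PSL2Z.

Definition psl (M : SL2Z) : PSL2Z := \pi_PSL2Z M.

Lemma psl_eq M N : psl M = psl N <-> sl_pm M N.
Proof. by split=> [/eqP|h]; last apply/eqP; rewrite /psl piE. Qed.

Definition psl_mul (g h : PSL2Z) : PSL2Z := psl (repr g * repr h)%g.
Definition psl_inv (g : PSL2Z) : PSL2Z := psl (repr g)^-1%g.

Fact sl_pm_repr M : sl_pm (repr (psl M)) M.
Proof. by apply/psl_eq; rewrite /psl reprK. Qed.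

Lemma psl_mulE M N : psl_mul (psl M) (psl N) = psl (M * N)%g.
Proof.
apply/psl_eq; rewrite /sl_pm /=.
by case/orP: (sl_pm_repr M) => /eqP->; case/orP: (sl_pm_repr N) => /eqP->;
  rewrite ?mulmxN ?mulNmx ?opprK eqxx ?orbT.
Qed.
Fact sl_oneE : slmx (1%g : SL2Z) = 1%:M. Proof. by []. Qed.
Fact sl_mulE (M N : SL2Z) : slmx (M * N)%g = slmx M *m slmx N. Proof. by []. Qed.
Fact psl_ind (P : PSL2Z -> Prop) : (forall M, P (psl M)) -> forall g, P g.
Proof. by move=> PM g; rewrite -[g]reprK. Qed.
Fact psl_mulA : associative psl_mul.
Proof.
by elim/psl_ind=> M; elim/psl_ind=> N; elim/psl_ind=> P; rewrite !psl_mulE mulgA.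
Qed.
Fact psl_mul1 : left_id (psl 1%g) psl_mul.
Proof. by elim/psl_ind=> M; rewrite psl_mulE mul1g. Qed.
Fact psl_mulr1 : right_id (psl 1%g) psl_mul.
Proof. by elim/psl_ind=> M; rewrite psl_mulE mulg1. Qed.
Fact psl_mulV : left_inverse (psl 1%g) psl_inv psl_mul.
Proof.
move=> g; rewrite -{2}[g]reprK -[\pi_ _ _]/(psl _) /psl_inv psl_mulE.
by rewrite mulVg.
Qed.
Fact psl_mulrV : right_inverse (psl 1%g) psl_inv psl_mul.
Proof.
move=> g; rewrite -{1}[g]reprK -[\pi_ _ _]/(psl _) /psl_inv psl_mulE.
by rewrite mulgV.
Qed.
HB.instance Definition _ :=
  isGroup.Build PSL2Z psl_mulA psl_mul1 psl_mulr1 psl_mulV psl_mulrV.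
Lemma pslM M N : psl (M * N)%g = (psl M * psl N)%g.
Proof. by rewrite [RHS]psl_mulE. Qed.

Lemma psl1 : psl 1%g = 1%g. Proof. by []. Qed.

Definition mx2 (a b c d : int) : 'M[int]_2 :=
  \matrix_(i, j) if i == 0 then if j == 0 then a else b
                 else if j == 0 then c else d.
Lemma mx2E (M : 'M[int]_2) : M = mx2 (M 0 0) (M 0 1) (M 1 0) (M 1 1).
Proof.
by apply/matrixP=> i j; rewrite mxE; case: i j => -[|[|//]] ? [[|[|//]] ?] /=;
  congr (M _ _); apply/val_inj.
Qed.
Lemma mx2M a b c d a' b' c' d' : mx2 a b c d *m mx2 a' b' c' d' =
  mx2 (a * a' + b * c') (a * b' + b * d') (c * a' + d * c') (c * b' + d * d').
Proof.
rewrite [LHS]mx2E; congr mx2;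
 by rewrite !mxE !big_ord_recl big_ord0 !mxE /= addr0.
Qed.
Lemma mx2N a b c d : - mx2 a b c d = mx2 (-a) (-b) (-c) (-d).
Proof. by rewrite [LHS]mx2E; congr mx2; rewrite !mxE. Qed.
Lemma mx2_1 : 1%:M = mx2 1 0 0 1.
Proof. by rewrite [LHS]mx2E; congr mx2; rewrite !mxE. Qed.
Lemma det_mx2E a b c d : \det (mx2 a b c d) = a * d - b * c.
Proof.
rewrite (expand_det_row _ 0) !big_ord_recl big_ord0 /cofactor !det_mx11 !mxE /=.
by ring.
Qed.

(* The matrices of z |-> - 1 / z and z |-> (z - 1) / z. *)
Fact slS_subproof : \det (mx2 0 (-1) 1 0) == 1.
Proof. by rewrite det_mx2E. Qed.
Fact slL_subproof : \det (mx2 1 (-1) 1 0) == 1.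
Proof. by rewrite det_mx2E. Qed.
Definition pS : PSL2Z := psl (SL2 slS_subproof).
Definition pL : PSL2Z := psl (SL2 slL_subproof).

Lemma pSS : (pS * pS = 1)%g.
Proof.
rewrite -pslM -psl1; apply/psl_eq; rewrite /sl_pm sl_mulE sl_oneE /= mx2M mx2_1.
by rewrite mx2N orbC /= eqxx.
Qed.
Lemma pLLL : (pL * pL * pL = 1)%g.
Proof.
rewrite -(pslM (SL2 slL_subproof) (SL2 slL_subproof)) -pslM -psl1; apply/psl_eq; rewrite /sl_pm !sl_mulE sl_oneE /= !mx2M mx2_1.
by rewrite mx2N orbC /= eqxx.
Qed.

(* [lL false] is L and [lL true] is L^2 = L^-1. *)
Inductive letter := lS | lL of bool.
Definition isS (x : letter) : bool := if x is lS then true else false.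
Definition word := seq letter.
Definition reduced (w : word) : bool :=
  sorted (fun x y => isS x != isS y) w.
Definition startsS (w : word) : bool := if w is lS :: _ then true else false.

Definition letter_val (x : letter) : PSL2Z :=
  match x with lS => pS | lL false => pL | lL true => (pL * pL)%g end.
Definition eval (w : word) : PSL2Z := (\prod_(x <- w) letter_val x)%g.

Lemma eval_nil : eval [::] = 1%g. Proof. by rewrite /eval big_nil. Qed.
Lemma eval_cons x w : eval (x :: w) = (letter_val x * eval w)%g.
Proof. by rewrite /eval big_cons. Qed.
Lemma eval_rcons w x : eval (rcons w x) = (eval w * letter_val x)%g.
Proof. by elim: w => [|y w IH]; rewrite /= !eval_cons ?eval_nil ?mulg1 ?mul1g // IH mulgA. Qed.

Lemma reduced_cons x w : reduced (x :: w) =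
  (if w is y :: _ then isS x != isS y else true) && reduced w.
Proof. by case: w. Qed.

(* Every element of PSL2Z is the value of a reduced word: Euclid's algorithm
   on the first column. *)
Definition good (g : PSL2Z) := exists2 w, reduced w & eval w = g.

Lemma good_S g : good g -> good (pS * g)%g.
Proof.
case=> w rw <-; case: w rw => [|[|e] w] rw.
- by exists [:: lS] => //; rewrite eval_cons.
- exists w; first by move: rw; rewrite reduced_cons => /andP[].
  by rewrite eval_cons mulgA pSS mul1g.
- exists [:: lS, lL e & w]; last by rewrite eval_cons.
  by rewrite reduced_cons rw.
Qed.
Lemma good_L g : good g -> good (pL * g)%g.
Proof.
case=> w rw <-; case: w rw => [|[|e] w] rw.
- by exists [:: lL false] => //; rewrite eval_cons.
- exists [:: lL false, lS & w]; last by rewrite eval_cons.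
  by rewrite reduced_cons rw.
case: e rw => rw.
- exists w; first by move: rw; rewrite reduced_cons => /andP[].
  by rewrite eval_cons /= !mulgA pLLL mul1g.
- exists (lL true :: w); last by rewrite !eval_cons /= mulgA.
  by move: rw; rewrite !reduced_cons.
Qed.

Definition sl a b c d (H : \det (mx2 a b c d) == 1) : PSL2Z := psl (SL2 H).
Lemma sl_eq a b c d H a' b' c' d' H' :
  [/\ a = a', b = b', c = c' & d = d'] \/
  [/\ a = - a', b = - b', c = - c' & d = - d'] ->
  @sl a b c d H = @sl a' b' c' d' H'.
Proof.
move=> h; apply/psl_eq; rewrite /sl_pm /= mx2N.
by case: h => -[-> -> -> ->]; rewrite eqxx ?orbT.
Qed.
Lemma slM a b c d H a' b' c' d' H' (K : \det _ == 1) :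
  (@sl a b c d H * @sl a' b' c' d' H')%g =
  @sl (a * a' + b * c') (a * b' + b * d') (c * a' + d * c') (c * b' + d * d') K.
Proof. by rewrite /sl -pslM; apply/psl_eq; rewrite /sl_pm sl_mulE /= mx2M eqxx. Qed.
Fact det2 a b c d : a * d - b * c = 1 :> int -> \det (mx2 a b c d) == 1.
Proof. by rewrite det_mx2E => ->. Qed.

Fact slT_subproof : \det (mx2 1 1 0 1) == 1. Proof. by rewrite det_mx2E. Qed.
Fact slV_subproof : \det (mx2 1 0 1 1) == 1. Proof. by rewrite det_mx2E. Qed.
Definition pT := sl slT_subproof.
Definition pV := sl slV_subproof.
Lemma pTE : pT = (pL * pS)%g.
Proof.
rewrite /pL /pS -pslM; apply/psl_eq; rewrite /sl_pm sl_mulE /= mx2M mx2N.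
by rewrite orbC /= eqxx.
Qed.
Lemma pVE : pV = (pL * pL * pS)%g.
Proof.
rewrite -(pslM (SL2 slL_subproof) (SL2 slL_subproof)) -pslM; apply/psl_eq; rewrite /sl_pm !sl_mulE /= !mx2M mx2N.
by rewrite orbC /= eqxx.
Qed.
Lemma good_T g : good g -> good (pT * g)%g.
Proof. by move=> /good_S/good_L; rewrite mulgA -pTE. Qed.
Lemma good_S' g : good (pS * g)%g -> good g.
Proof. by move=> /good_S; rewrite mulgA pSS mul1g. Qed.
Lemma good_T' g : good (pT * g)%g -> good g.
Proof.
by move=> /good_L/good_L; rewrite pTE !mulgA pLLL mul1g => /good_S'.
Qed.

Fact int_mul_eq1 (a d : int) :
  a * d = 1 -> a = 1 /\ d = 1 \/ a = -1 /\ d = -1.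
Proof.
move=> ad; have: (`|a| * `|d| == 1)%N by rewrite -abszM ad.
rewrite muln_eq1 => /andP[/eqP a1 /eqP d1].
have [a_|a_] : a = 1 \/ a = -1 by lia.
  by left; move: ad; rewrite a_ mul1r.
by right; move: ad; rewrite a_ mulN1r => ?; split=> //; lia.
Qed.

Lemma good_upper n a b d H : (`|b| <= n)%N -> good (@sl a b 0 d H).
Proof.
elim: n a b d H => [|n IH] a b d H bn; have := H; rewrite det_mx2E mulr0 subr0 => /eqP ad.
  exists [::] => //; rewrite eval_nil -psl1; apply/esym/psl_eq; rewrite /sl_pm sl_oneE mx2_1 /= mx2N.
  have -> : b = 0 by lia.
  have [[-> ->]|[-> ->]] := int_mul_eq1 ad.
  - by rewrite eqxx.
  - by rewrite !oppr0 ?opprK eqxx ?orbT.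
have da : d = a by case: (int_mul_eq1 ad) => -[-> ->].
subst d.
have a1 : a = 1 \/ a = -1 by case: (int_mul_eq1 ad) => -[-> _]; [left|right].
have [b0|b0] : b * a <= 0 \/ b * a > 0 by lia.
  have [bz|bz] := eqVneq b 0; first by apply: IH; rewrite bz.
  have K : \det (mx2 a (b + a) 0 a) == 1 by apply: det2; rewrite ad mulr0 subr0.
  apply: good_T'; rewrite /pT slM.
    by apply: det2; rewrite !mul1r !mul0r !add0r; lia.
  move=> K'; rewrite (@sl_eq _ _ _ _ _ _ _ _ _ K); first by apply: IH; nia.
  by left; split; ring.
have K : \det (mx2 a (b - a) 0 a) == 1 by apply: det2; rewrite ad mulr0 subr0.
have -> : sl H = (pT * sl K)%g.
  rewrite /pT slM; first by apply: det2; rewrite !mul1r !mul0r !add0r; lia.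
  by move=> K'; apply: sl_eq; left; split; ring.
by apply/good_T/IH; nia.
Qed.

Lemma good_all n a b c d H : (`|a| + 2 * `|c| <= n)%N -> good (@sl a b c d H).
Proof.
elim: n a b c d H => [|n IH] a b c d H bn; have := H; rewrite det_mx2E => /eqP ad.
  have a0 : a = 0 by lia.
  have c0 : c = 0 by lia.
  by exfalso; move: ad; rewrite a0 c0 mul0r mulr0.
have [c0|c0] := eqVneq c 0; first by subst c; exact: (good_upper (n := `|b|%N)).
have [ac|ac] := ltnP `|a| `|c|.
  have K : \det (mx2 (-c) (-d) a b) == 1 by apply: det2; lia.
  apply: good_S'; have -> : (pS * sl H)%g = sl K; last by apply: IH; lia.
  rewrite [pS]/(sl slS_subproof) slM; first by apply: det2; lia.
  by move=> K'; apply: sl_eq; left; split; ring.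
have [s|s] : a * c <= 0 \/ 0 < a * c by lia.
  have K : \det (mx2 (a + c) (b + d) c d) == 1 by apply: det2; lia.
  apply: good_T'; have -> : (pT * sl H)%g = sl K; last by apply: IH; nia.
  rewrite /pT slM; first by apply: det2; lia.
  by move=> K'; apply: sl_eq; left; split; ring.
have K : \det (mx2 (a - c) (b - d) c d) == 1 by apply: det2; lia.
have -> : sl H = (pT * sl K)%g; last by apply/good_T/IH; nia.
rewrite /pT slM; first by apply: det2; lia.
by move=> K'; apply: sl_eq; left; split; ring.
Qed.

Lemma psl_good g : good g.
Proof.
elim/psl_ind: g => -[M detM]; have := detM; rewrite {1}(mx2E M) => H.
have := @good_all _ _ _ _ _ H (leqnn _).
suff -> : sl H = psl (SL2 detM) by [].
by apply/psl_eq; rewrite /sl_pm /= -mx2E eqxx.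
Qed.

(* The reduced word is unique: the inner product of the two rows of a matrix,
   which is insensitive to sign, is positive exactly when the word begins with
   L or L^2. *)
Definition rowdot (g : PSL2Z) : int :=
  let M := slmx (repr g) in M 0 0 * M 1 0 + M 0 1 * M 1 1.
Lemma rowdot_sl a b c d H : rowdot (@sl a b c d H) = a * c + b * d.
Proof.
rewrite /rowdot /sl; case/orP: (sl_pm_repr (SL2 H)) => /eqP-> /=;
  by rewrite ?mx2N !mxE /=; ring.
Qed.
Lemma sl_ind (P : PSL2Z -> Prop) :
  (forall a b c d H, P (@sl a b c d H)) -> forall g, P g.
Proof.
move=> PM; elim/psl_ind=> -[M detM]; have := detM; rewrite {1}(mx2E M) => H.
suff <- : sl H = psl (SL2 detM) by [].
by apply/psl_eq; rewrite /sl_pm /= -mx2E eqxx.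
Qed.
Lemma rowdot_Sl g : rowdot (pS * g)%g = - rowdot g.
Proof.
elim/sl_ind: g => a b c d H; rewrite [pS]/(sl slS_subproof) slM.
  by apply: det2; move: H; rewrite det_mx2E => /eqP; lia.
by move=> K; rewrite !rowdot_sl; ring.
Qed.
Lemma rowdot_Sr g : rowdot (g * pS)%g = rowdot g.
Proof.
elim/sl_ind: g => a b c d H; rewrite [pS]/(sl slS_subproof) slM.
  by apply: det2; move: H; rewrite det_mx2E => /eqP; lia.
by move=> K; rewrite !rowdot_sl; ring.
Qed.
Fact sl1_subproof : \det (mx2 1 0 0 1) == 1. Proof. by rewrite det_mx2E. Qed.
Lemma sl1E : sl sl1_subproof = 1%g.
Proof. by rewrite -psl1; apply/psl_eq; rewrite /sl_pm sl_oneE mx2_1 eqxx. Qed.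

Definition endS (t : bool) : PSL2Z := if t then pS else 1%g.

Lemma lLE e : letter_val (lL e) = ((if e then pV else pT) * pS)%g.
Proof. by case: e; rewrite ?pVE ?pTE -mulgA pSS mulg1. Qed.

Lemma reduced_pos w : reduced w -> ~~ startsS w ->
  exists a b c d, exists H, exists t,
  [/\ [/\ 0 <= a, 0 <= b, 0 <= c & 0 <= d],
      w <> [::] -> 0 < a * c + b * d & eval w = (@sl a b c d H * endS t)%g].
Proof.
have [n] := ubnP (size w); elim: n w => // n IH [|[|e] w] //.
  move=> _ _ _; exists 1, 0, 0, 1, sl1_subproof, false; split=> //.
  by rewrite eval_nil sl1E mulg1.
rewrite ltnS => wn rw _.
have [a [b [c [d [H [t [[a0 b0 c0 d0] E]]]]]]] :
  exists a b c d, exists H, exists t,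
  [/\ 0 <= a, 0 <= b, 0 <= c & 0 <= d] /\
  (pS * eval w = (@sl a b c d H * endS t))%g.
  case: w wn rw => [|[|e'] w] wn rw //.
    exists 1, 0, 0, 1, sl1_subproof, true; split=> //.
    by rewrite eval_nil sl1E mulg1 mul1g.
  have [||| a [b [c [d [H [t [P _ E]]]]]]] := IH w.
  - by rewrite (leq_trans _ wn).
  - by move: rw; rewrite !reduced_cons => /and3P[].
  - by move: rw; rewrite !reduced_cons; case: (w) => [|[]].
  exists a, b, c, d, H, t; split=> //.
  by rewrite eval_cons mulgA pSS mul1g.
have dt : a * d - b * c = 1 by have := H; rewrite det_mx2E => /eqP.
have Kv : \det (mx2 a b (a + c) (b + d)) == 1 by apply: det2; lia.
have Kt : \det (mx2 (a + c) (b + d) c d) == 1 by apply: det2; lia.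
have sq (x y u v : int) : 0 <= x -> 0 <= y -> x * u - y * v = 1 ->
    0 < x * x + y * y.
  move=> x0 y0 xy; have [xp|xn] := ltrP 0 x; first by nia.
  have [yp|yn] := ltrP 0 y; first by nia.
  have x_ : x = 0 by lia.
  have y_ : y = 0 by lia.
  by move: xy; rewrite x_ y_ !mul0r.
have ab : 0 < a * a + b * b by exact: (sq a b d c).
have cd : 0 < c * c + d * d by rewrite addrC; apply: (sq d c a b) => //; lia.
case: e wn rw => _ rw.
  exists a, b, (a + c), (b + d), Kv, t; split; first by split; lia.
    by move=> _; nia.
  rewrite eval_cons lLE -mulgA E mulgA; congr (_ * _)%g.
  rewrite /pV slM; first by apply: det2; lia.
  by move=> K; apply: sl_eq; left; split; ring.
exists (a + c), (b + d), c, d, Kt, t; split; first by split; lia.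
  by move=> _; nia.
rewrite eval_cons lLE -mulgA E mulgA; congr (_ * _)%g.
rewrite /pT slM; first by apply: det2; lia.
by move=> K; apply: sl_eq; left; split; ring.
Qed.

Definition startsL (w : word) : bool := if w is lL _ :: _ then true else false.

Lemma rowdot_endS g t : rowdot (g * endS t)%g = rowdot g.
Proof. by case: t; rewrite /endS ?rowdot_Sr ?mulg1. Qed.
Lemma rowdot_startsL w : reduced w -> startsL w = (0 < rowdot (eval w)).
Proof.
case: w => [|[|e] w] rw.
- by rewrite eval_nil -sl1E rowdot_sl.
- apply/esym/negbTE; rewrite -leNgt eval_cons rowdot_Sl oppr_le0.
  have rw' : reduced w by move: rw; rewrite reduced_cons => /andP[].
  have wS : ~~ startsS w by move: rw; rewrite reduced_cons; case: (w) => [|[]].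
  have [a [b [c [d [H [t [[a0 b0 c0 d0] _ ->]]]]]]] := reduced_pos rw' wS.
  by rewrite rowdot_endS rowdot_sl; nia.
- have [//|a [b [c [d [H [t [_ P ->]]]]]]] := reduced_pos rw.
  by rewrite rowdot_endS rowdot_sl P.
Qed.

Lemma reduced_behead x w : reduced (x :: w) -> reduced w.
Proof. by rewrite reduced_cons => /andP[]. Qed.

Lemma eval_inj w1 w2 : reduced w1 -> reduced w2 -> eval w1 = eval w2 -> w1 = w2.
Proof.
have LL u v : reduced (lL false :: u) -> reduced (lL true :: v) ->
    eval (lL false :: u) = eval (lL true :: v) -> False.
  move=> ru rv; rewrite !eval_cons /= -mulgA => /mulgI E.
  have rv' : reduced (lL false :: v) by move: rv; rewrite !reduced_cons.
  have /esym := rowdot_startsL rv'; rewrite eval_cons /= -E.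
  rewrite -rowdot_startsL ?(reduced_behead ru) //.
  by move: ru; rewrite reduced_cons; case: (u) => [|[]].
have NS v : reduced (lS :: v) -> eval [::] = eval (lS :: v) -> False.
  move=> rv; rewrite eval_nil eval_cons => /(congr1 (fun g => pS * g)%g).
  rewrite /= mulgA pSS mul1g mulg1 => E.
  have := rowdot_startsL (reduced_behead rv); rewrite -E.
  rewrite -[pS]mulg1 rowdot_Sl -sl1E rowdot_sl /=.
  case: v rv E => [|[|]] //; rewrite eval_nil => _ /(congr1 repr) E _.
  have := sl_pm_repr (SL2 slS_subproof); rewrite -[psl _]/pS E.
  have := sl_pm_repr 1%g; rewrite psl1 /sl_pm sl_oneE /= mx2N mx2_1.
  by case/orP=> /eqP-> /orP[] /eqP /matrixP /(_ 0 0); rewrite !mxE.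
elim: w1 w2 => [|x w1 IH] [|y w2] // r1 r2 E.
- case: y r2 E => [|e] r2 E; first by case: (NS _ r2).
  by have := rowdot_startsL r2; rewrite -E -rowdot_startsL.
- case: x r1 E => [|e] r1 E; first by case: (NS _ r1 (esym E)).
  by have := rowdot_startsL r1; rewrite E -rowdot_startsL.
have xy : x = y.
  have := rowdot_startsL r1; rewrite E -rowdot_startsL //.
  case: x y r1 r2 E => [|[|]] [|[|]] //= r1 r2 E _.
    by case: (LL _ _ r2 r1 (esym E)).
  by case: (LL _ _ r1 r2 E).
move: E; rewrite xy !eval_cons => /mulgI /IH -> //.
  exact: reduced_behead r1.
exact: reduced_behead r2.
Qed.

Definition word_of (g : PSL2Z) : word := s2val (cid2 (psl_good g)).

Lemma word_of_reduced g : reduced (word_of g).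
Proof. by rewrite /word_of; case: cid2. Qed.
Lemma word_ofK g : eval (word_of g) = g.
Proof. by rewrite /word_of; case: cid2. Qed.
Lemma evalK w : reduced w -> word_of (eval w) = w.
Proof. by move=> rw; apply: eval_inj (word_of_reduced _) rw (word_ofK _). Qed.

(* The bipartite Farey tree has edge set PSL2Z; its vertices are the left
   cosets of <S> (2-valent) and of <L> (3-valent). *)
Definition coset2 (W : PSL2Z) : set PSL2Z := [set W; (W * pS)%g].
Definition coset3 (W : PSL2Z) : set PSL2Z :=
  [set W; (W * pL)%g; (W * (pL * pL))%g].
Definition is_vertex (v : set PSL2Z) : Prop :=
  exists W, v = coset2 W \/ v = coset3 W.

Record vertex := Vertex { vset :> set PSL2Z; vertexP : is_vertex vset }.

Definition adjacent (v w : vertex) : Prop := v <> w /\ (v `&` w) !=set0.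

(* The tree is simple, so an automorphism is determined by its action on the
   vertices; an edge is the common element of its two end points. *)
Record treeAut := TreeAut {
  aut_fun :> vertex -> vertex;
  aut_bij : bijective aut_fun;
  aut_adj : forall v w, adjacent (aut_fun v) (aut_fun w) <-> adjacent v w }.

Fact aut_comp_adj (f g : treeAut) v w :
  adjacent ((f \o g) v) ((f \o g) w) <-> adjacent v w.
Proof. exact: iff_trans (aut_adj f _ _) (aut_adj g _ _). Qed.
Definition aut_comp (f g : treeAut) : treeAut :=
  TreeAut (bij_comp (aut_bij f) (aut_bij g)) (aut_comp_adj f g).

Lemma vertex_eq (v w : vertex) : vset v = vset w -> v = w.
Proof.
case: v w => [v vP] [w wP] /= E; case: _ / E in wP *.
by congr Vertex; exact: Prop_irrelevance.
Qed.

Definition edge_map (F : word -> word) (g : PSL2Z) : PSL2Z :=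
  eval (F (word_of g)).

(* F is an involution which exchanges L and L^2 or not at each letter, depending
   only on the prefix preceding it, i.e. on the 3-valent vertex crossed there;
   [edge_map F] then induces an automorphism of the tree. *)
Record word_aut (F : word -> word) : Prop := WordAut {
  word_autK : involutive F;
  word_aut_nil : F [::] = [::];
  word_autS : forall w, F (rcons w lS) = rcons (F w) lS;
  word_autL : forall w,
    exists h, forall e, F (rcons w (lL e)) = rcons (F w) (lL (e (+) h)) }.

Definition ends_in (b : bool) (w : word) : bool :=
  if w is x :: w' then isS (last x w') == b else false.

Lemma ends_in_rcons b w x : ends_in b (rcons w x) = (isS x == b).
Proof. by case: w => //= y w; rewrite last_rcons. Qed.
Lemma reduced_rcons w x :
  reduced (rcons w x) = reduced w && ~~ ends_in (isS x) w.
Proof. by case: w => //= y w; rewrite /reduced /= rcons_path. Qed.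

Section WordAut.
Variables (F : word -> word) (hF : word_aut F).

Lemma word_aut_ends b w : ends_in b (F w) = ends_in b w.
Proof.
case/lastP: w => [|w x]; first by rewrite (word_aut_nil hF).
case: x => [|e]; first by rewrite (word_autS hF) !ends_in_rcons.
by have [h ->] := word_autL hF w; rewrite !ends_in_rcons.
Qed.
Lemma word_aut_reduced w : reduced w -> reduced (F w).
Proof.
elim/last_ind: w => [|w x IH]; first by rewrite (word_aut_nil hF).
case: x => [|e]; rewrite reduced_rcons => /andP[rw ew].
  by rewrite (word_autS hF) reduced_rcons IH // word_aut_ends.
by have [h ->] := word_autL hF w; rewrite reduced_rcons IH // word_aut_ends.
Qed.
Lemma edge_map_eval w : reduced w -> edge_map F (eval w) = eval (F w).
Proof. by move=> rw; rewrite /edge_map evalK. Qed.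
Lemma edge_mapK : involutive (edge_map F).
Proof.
move=> g; rewrite [edge_map F g]/edge_map edge_map_eval.
  by rewrite (word_autK hF) word_ofK.
exact/word_aut_reduced/word_of_reduced.
Qed.
Lemma edge_map1 : edge_map F 1%g = 1%g.
Proof. by rewrite -eval_nil edge_map_eval // (word_aut_nil hF). Qed.
Lemma edge_mapS g : edge_map F (g * pS)%g = (edge_map F g * pS)%g.
Proof.
rewrite -[g]word_ofK; set w := word_of g.
have rw : reduced w := word_of_reduced g.
case: (boolP (ends_in true w)) => [|ew]; last first.
  rewrite -(eval_rcons w lS) !edge_map_eval // ?reduced_rcons ?rw //.
  by rewrite (word_autS hF) eval_rcons.
case/lastP: w rw => [//|w [|e]]; rewrite ends_in_rcons // reduced_rcons.
case/andP=> rw ew _; rewrite eval_rcons -mulgA pSS mulg1.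
rewrite -(eval_rcons w lS) !edge_map_eval // ?reduced_rcons ?rw //.
by rewrite (word_autS hF) eval_rcons -mulgA pSS mulg1.
Qed.

Lemma pLE (b : bool) : letter_val (lL b) = if b then (pL * pL)%g else pL.
Proof. by case: b. Qed.
Lemma coset3L g : coset3 (g * pL)%g = coset3 g.
Proof.
by apply/seteqP; split=> x; rewrite /coset3 /= !mulgA;
  rewrite ?[(g * pL * pL * pL)%g]mulgA -?(mulgA g) -?(mulgA pL) ?(mulgA pL pL) pLLL mulg1;
  tauto.
Qed.
Lemma coset3_base g : exists u,
  [/\ reduced u, ~~ ends_in false u & coset3 (eval u) = coset3 g].
Proof.
rewrite -[g]word_ofK; set w := word_of g.
have rw : reduced w := word_of_reduced g.
case: (boolP (ends_in false w)) => [|ew]; last by exists w.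
case/lastP: w rw => [//|w [|e]]; rewrite ends_in_rcons // reduced_rcons.
case/andP=> rw /= ew _; exists w; split=> //.
by rewrite eval_rcons pLE; case: e; rewrite ?mulgA !coset3L.
Qed.
Lemma edge_map_coset2 g : edge_map F @` coset2 g = coset2 (edge_map F g).
Proof. by rewrite /coset2 image_setU !image_set1 edge_mapS. Qed.
Lemma edge_map_coset3 u : reduced u -> ~~ ends_in false u ->
  edge_map F @` coset3 (eval u) = coset3 (eval (F u)).
Proof.
move=> ru eu; rewrite /coset3 !image_setU !image_set1.
have [h hE] := word_autL hF u.
have E e : edge_map F (eval u * letter_val (lL e))%g =
    (eval (F u) * letter_val (lL (e (+) h)))%g.
  by rewrite -eval_rcons edge_map_eval ?hE ?eval_rcons // reduced_rcons ru.
rewrite edge_map_eval // (E false) (E true); case: h {hE E} => //=.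
by rewrite -!setUA [X in _ `|` X]setUC.
Qed.
Lemma edge_map_vertex v : is_vertex v -> is_vertex (edge_map F @` v).
Proof.
case=> W [->|->].
  by exists (edge_map F W); left; rewrite edge_map_coset2.
have [u [ru eu <-]] := coset3_base W.
by exists (eval (F u)); right; rewrite edge_map_coset3.
Qed.

Definition vertex_map (v : vertex) : vertex :=
  Vertex (edge_map_vertex (vertexP v)).
Lemma vertex_mapK : involutive vertex_map.
Proof.
move=> v; apply/vertex_eq; rewrite /= image_comp -[RHS]image_id.
by apply/eq_imagel => x _; exact: edge_mapK.
Qed.
Lemma vertex_map_adj v w :
  adjacent (vertex_map v) (vertex_map w) <-> adjacent v w.
Proof.
have h v' w' : adjacent v' w' -> adjacent (vertex_map v') (vertex_map w').
  case=> vw [x [vx wx]]; split.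
    by move=> /(can_inj vertex_mapK).
  by exists (edge_map F x); split; exists x.
by split=> /h //; rewrite !vertex_mapK.
Qed.
Definition word_treeAut : treeAut :=
  TreeAut (inv_bij vertex_mapK) vertex_map_adj.
End WordAut.

Definition swapL (x : letter) : letter := if x is lL e then lL (~~ e) else lS.
Definition U_word (w : word) : word := map swapL w.

(* Exchanges L and L^2 in every second letter L^{+-1}, starting with the first
   such letter if b, with the second one otherwise. *)
Fixpoint swap_alt (b : bool) (w : word) : word :=
  match w with
  | [::] => [::]
  | lS :: w' => lS :: swap_alt b w'
  | lL e :: w' => (if b then swapL (lL e) else lL e) :: swap_alt (~~ b) w'
  end.
Definition J_word (w : word) : word := swap_alt (startsS w) w.

Fact U_word_aut : word_aut U_word.
Proof.
split=> // [w|w|w].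
- by elim: w => //= -[|e] w -> //=; rewrite negbK.
- by rewrite /U_word map_rcons.
- by exists true => e; rewrite /U_word map_rcons /= addbT.
Qed.

Fact swap_alt_rconsS b w : swap_alt b (rcons w lS) = rcons (swap_alt b w) lS.
Proof. by elim: w b => [|[|e] w IH] b //=; rewrite IH. Qed.
Fact swap_alt_rconsL b w : exists h, forall e,
  swap_alt b (rcons w (lL e)) = rcons (swap_alt b w) (lL (e (+) h)).
Proof.
elim: w b => [|[|e'] w IH] b.
- by exists b => e /=; case: b; rewrite ?addbT ?addbF.
- by have [h hE] := IH b; exists h => e /=; rewrite hE.
- by have [h hE] := IH (~~ b); exists h => e /=; rewrite hE.
Qed.
Fact swap_altK b : involutive (swap_alt b).
Proof.
move=> w; elim: w b => [|[|e] w IH] [] //=; rewrite ?negbK ?IH //.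
Qed.
Fact J_word_aut : word_aut J_word.
Proof.
have sS b w : startsS (swap_alt b w) = startsS w by case: w b => [|[|e] w] [].
split=> // [w|w|w]; rewrite /J_word.
- by rewrite sS swap_altK.
- by rewrite swap_alt_rconsS; case: w => [|[]].
- case: w => [|x w]; first by exists false => e; rewrite addbF.
  have [h hE] := swap_alt_rconsL (startsS (x :: w)) (x :: w).
  by exists h => e; rewrite -hE; case: (x).
Qed.

Definition U_F : treeAut := word_treeAut U_word_aut.
Definition J_F : treeAut := word_treeAut J_word_aut.

(* The infinite reduced words: (false, a) is a and (true, a) is S a, where the
   digit 0 (false) stands for L S and the digit 1 (true) for L^2 S. *)
Definition boundary : Type := (bool * (nat -> bool))%type.
HB.instance Definition _ := Choice.on boundary.
HB.instance Definition _ := Pointed.on boundary.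

Definition phi : nat -> bool := odd.
Definition phi_star (i : nat) : bool := ~~ odd i.

Definition U_bd (w : boundary) : boundary := (w.1, fun i => ~~ w.2 i).
Definition J_bd (w : boundary) : boundary :=
  (w.1, fun i => w.2 i (+) (if w.1 then phi_star i else phi i)).

(* [U_bd] and [J_bd] are the maps induced by the tree automorphisms on the
   infinite paths issued from the edge 1: see [U_edge_prefix], [J_edge_prefix]. *)
Definition digit_letter (a : nat -> bool) (i : nat) : letter :=
  if odd i then lS else lL (a i./2).
Definition bd_letter (w : boundary) (i : nat) : letter :=
  if w.1 then if i is i'.+1 then digit_letter w.2 i' else lS
  else digit_letter w.2 i.
Definition bd_prefix (w : boundary) (n : nat) : word := mkseq (bd_letter w) n.

Lemma mkseqSr T (f : nat -> T) n : mkseq f n.+1 = rcons (mkseq f n) (f n).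
Proof. by rewrite /mkseq -cats1 -addn1 iotaD map_cat. Qed.

Lemma bd_prefix_reduced w n : reduced (bd_prefix w n).
Proof.
rewrite /bd_prefix; elim: n => // n IH; rewrite mkseqSr reduced_rcons IH /=.
case: n {IH} => // n; rewrite mkseqSr ends_in_rcons.
case: w => [[] a]; rewrite /bd_letter /digit_letter /=.
  by case: n => //= n; case: (odd n).
by case: (odd n).
Qed.

Lemma U_edge_prefix w n :
  edge_map U_word (eval (bd_prefix w n)) = eval (bd_prefix (U_bd w) n).
Proof.
rewrite edge_map_eval ?bd_prefix_reduced //; congr eval.
rewrite /U_word /bd_prefix /mkseq -map_comp; apply: eq_map => i /=.
by case: w => [[] a]; rewrite /bd_letter /digit_letter /=; case: i => [|i] //=;
  case: (odd i).
Qed.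

Lemma mkseqSl T (f : nat -> T) n : mkseq f n.+1 = f 0%N :: mkseq (f \o succn) n.
Proof. by rewrite /mkseq /= -[1%N]addn0 iotaDl -map_comp. Qed.
Lemma swap_alt_digits b a n : swap_alt b (mkseq (digit_letter a) n) =
  mkseq (digit_letter (fun i => a i (+) (b (+) odd i))) n.
Proof.
have [k] := ubnP n; elim: k n b a => // k IH [|[|n]] b a //.
  by move=> _; rewrite !mkseqSl /= /digit_letter /=; case: b; rewrite ?addbT ?addbF.
rewrite ltnS => nk; rewrite !mkseqSl /=.
have D (a' : nat -> bool) :
    (digit_letter a' \o succn) \o succn = digit_letter (a' \o succn).
  by apply/funext=> i; rewrite /digit_letter /= negbK.
rewrite !D IH ?(leq_trans _ nk) //=; congr [:: _, _ & _].
  by rewrite /digit_letter /=; case: (b); rewrite ?addbT ?addbF.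
apply: eq_mkseq => i; rewrite /digit_letter /=.
by case: b (odd i./2) => -[].
Qed.
Lemma J_edge_prefix w n :
  edge_map J_word (eval (bd_prefix w n)) = eval (bd_prefix (J_bd w) n).
Proof.
rewrite edge_map_eval ?bd_prefix_reduced //.
congr eval; case: w => [[] a]; rewrite /J_word /bd_prefix.
  case: n => // n; rewrite !mkseqSl /=; congr (_ :: _).
  by rewrite -[_ \o _]/(digit_letter a) swap_alt_digits.
have -> : startsS (mkseq (bd_letter (false, a)) n) = false by case: n.
by rewrite -[bd_letter _]/(digit_letter a) swap_alt_digits.
Qed.

(* Length of the initial block of b's of a; None is infinity. *)
Definition run (b : bool) (a : nat -> bool) : option nat :=
  if pselect (exists i, a i != b) is left ex then Some (ex_minn ex) else None.
(* The exponents of a = b^(n_0) (~ b)^(n_1) b^(n_2) ...; the ones following an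
   infinite exponent are None too, which is harmless since cf_step None y is
   infinity for every y. *)
Fixpoint exponent (b : bool) (a : nat -> bool) (i : nat) : option nat :=
  match i, run b a with
  | 0, r => r
  | i'.+1, Some n => exponent (~~ b) (fun j => a (n + j)%N) i'
  | _.+1, None => None
  end.

(* The real projective line; None is the point at infinity. *)
Notation Rhat R := (one_point_compactification R).

Section RealLine.
Context {R : realType}.

Definition hopp (y : Rhat R) : Rhat R := if y is Some x then Some (- x) else None.
Definition hinv (y : Rhat R) : Rhat R :=
  if y is Some x then if x == 0 then None else Some x^-1 else Some 0.

(* n + 1 / y *)
Definition cf_step (n : option nat) (y : Rhat R) : Rhat R :=
  if (n, hinv y) is (Some n', Some z) then Some (n'%:R + z) else None.
(* The empty fraction is infinity, so that [n] = n + 1 / oo = n. *)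
Definition cf_fin (s : seq (option nat)) : Rhat R := foldr cf_step None s.
(* Limit taken in the one-point compactification; the sequence is eventually
   constant when some exponent is infinite. *)
Definition cfrac (n : nat -> option nat) : Rhat R :=
  lim ((fun k => cf_fin (mkseq n k)) @ \oo).

Definition kappa (w : boundary) : Rhat R :=
  let y := cfrac (exponent false w.2) in if w.1 then hopp (hinv y) else y.

(* The word w with kappa w = x, which is unique for x irrational; J_R x is only
   meaningful for such x. *)
Definition bd_of (x : R) : boundary := get [set w | kappa w = Some x].
Definition J_R (x : R) : Rhat R := kappa (J_bd (bd_of x)).
End RealLine.

(* Main.v *)
Require Import Defs.
From mathcomp Require Import all_boot all_order all_algebra.
From mathcomp Require Import all_classical all_reals all_analysis.
From mathcomp Require Import zify ring lra.
Set Implicit Arguments.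
Unset Strict Implicit.
Unset Printing Implicit Defensive.
Import Order.TTheory GRing.Theory Num.Theory.
Import numFieldNormedType.Exports.
Local Open Scope ring_scope.
Local Open Scope classical_set_scope.

(** U exchanges L and L^2 at every letter of a reduced word, and J at the
    letters in certain positions.  The positions depend on where the S's are,
    which U does not change; so the two commute on words, hence on edges and on
    vertices, and their boundary maps commute because both act on the digits by
    exclusive or.

    The functional equation is this commutation read through kappa.  It needs
    two facts.

    - kappa (U w) = 1 / kappa w for every w ([kappa_U]).  Negating the digits
      inserts or deletes an initial exponent 0, and [0, n_0, n_1, ...] is the
      inverse of [n_0, n_1, ...].  As kappa is a limit in the one-point
      compactification, this requires that this space is Hausdorff
      ([one_point_compactification_hausdorff]) and that continued fractions
      converge ([cfrac_cvg]).  The equation is needed for every w and not only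
      when kappa w is irrational, because J w may have a rational value, and the
      values 0 and oo are exchanged.

    - An irrational x has exactly one word w with kappa w = x ([kappaP]).  For
      x > 0, prepending the digit 0 to a word acts on its value by y |-> 1 + y,
      which is >= 1, and prepending 1 acts by y |-> 1 / (1 + 1 / y), which is
      <= 1; so the first digit tells whether x < 1 and the remaining digits
      represent the image of x by the Farey map.  This gives uniqueness.
      For existence, let z be the value of the word read off the orbit of x.  If
      z were not x, a positive fraction p / q would lie strictly between them;
      removing the first digit turns it into (p - q) / q or p / (q - p), again
      strictly between the corresponding values, and p + q cannot decrease for
      ever.

    Hence U maps the word of x to the word of 1 / x, and
    J(1/x) = kappa (J (U w)) = kappa (U (J w)) = 1 / J(x). *)

(** * Commutation on the tree and on its boundary *)

Lemma J_U_word w : J_word (U_word w) = U_word (J_word w).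
Proof.
have E b u : swap_alt b (U_word u) = U_word (swap_alt b u).
  by elim: u b => [|[|e] u IH] [] //=; rewrite IH.
by rewrite /J_word E; case: w => [|[]].
Qed.

Lemma treeAut_eq (f g : treeAut) : aut_fun f =1 aut_fun g -> f = g.
Proof.
case: f g => [f bf af] [g bg ag] /= /funext E.
by case: _ / E in bg ag *; congr TreeAut; exact: Prop_irrelevance.
Qed.

Lemma J_U_edge : edge_map J_word \o edge_map U_word =1
  edge_map U_word \o edge_map J_word.
Proof.
move=> g /=; rewrite [edge_map U_word g]/edge_map [edge_map J_word g]/edge_map.
have rw := word_of_reduced g.
rewrite !edge_map_eval ?J_U_word //; apply: word_aut_reduced => //.
- exact: J_word_aut.
- exact: U_word_aut.
Qed.

Lemma J_U_F : aut_comp J_F U_F = aut_comp U_F J_F.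
Proof.
apply: treeAut_eq => v; apply: vertex_eq; rewrite /= !image_comp.
by apply: eq_imagel => x _; exact: J_U_edge.
Qed.

Lemma J_U_bd w : J_bd (U_bd w) = U_bd (J_bd w).
Proof. by congr pair; apply/funext => i /=; rewrite addNb. Qed.

(** * Convergence in the projective line *)

(** A compact neighbourhood of a finite point and its complement separate that
    point from infinity. *)
Lemma one_point_compactification_hausdorff (X : topologicalType) :
  hausdorff_space X -> locally_compact [set: X] ->
  hausdorff_space (one_point_compactification X).
Proof.
move=> hX lX; pose Xo := one_point_compactification X.
have NSome (x : X) : cluster (nbhs (Some x : Xo)) (None : Xo) -> False.
  have [K] := lX x Logic.I; rewrite withinET => xK [cptK cloK].
  have oK : nbhs (None : Xo) ((Some @` (~` K)) `|` [set None]) by exists K.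
  move=> /(_ _ _ (one_point_compactification_some_nbhs _ _ xK) oK).
  by case=> _ [[y Ky <-] [[t nKt [E]]|//]]; apply: nKt; rewrite E.
case=> [x|] [y|] // xy; last 2 first.
- by case: (NSome x xy).
- by case: (NSome y); move=> A B yA NB; rewrite setIC; exact: xy.
congr Some; apply: hX => A B xA yB.
have [_ [[z Az <-] [t Bt [tz]]]] := xy _ _
  (one_point_compactification_some_nbhs _ _ xA)
  (one_point_compactification_some_nbhs _ _ yB).
by exists z; split=> //; rewrite -tz.
Qed.

Section RealLine.
Context {R : realType}.
Implicit Types (x y : R) (z : Rhat R) (a b : nat -> bool).

Definition hsucc z : Rhat R := if z is Some x then Some (1 + x) else None.

(** Convergence to infinity is required to be eventual equality.  The
    convergents of a fraction whose exponents after the first are nonzero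
    satisfy this, and it makes the passage of limits through hsucc and hinv a
    statement about real sequences. *)
Definition strong_cvg (s : nat -> Rhat R) z :=
  if z is Some x then
    exists2 u : nat -> R, (\forall k \near \oo, s k = Some (u k)) & u @ \oo --> x
  else \forall k \near \oo, s k = None.

Lemma strong_cvg_cvg s z : strong_cvg s z -> s @ \oo --> z.
Proof.
case: z => [x [u su ux]|sN] /=.
  apply: cvg_trans
    (cvg_comp _ _ ux (@one_point_compactification_some_continuous R x)).
  by apply: near_eq_cvg; apply: filterS su => k ->.
by apply: cvg_near_cst.
Qed.

Lemma strong_cvg_cst s z : (\forall k \near \oo, s k = z) -> strong_cvg s z.
Proof. by case: z => [x|] // sx; exists (fun=> x) => //; exact: cvg_cst. Qed.

Lemma strong_cvg_shift s z : strong_cvg (s \o succn) z <-> strong_cvg s z.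
Proof.
have E (P : set nat) :
    (\forall k \near \oo, P k.+1) <-> (\forall k \near \oo, P k).
  split=> -[N _ PN]; last by exists N => // k Nk; exact/PN/leqW.
  by exists N.+1 => // -[|k] //= Nk; exact: PN.
case: z => [x|] /=; last exact: (E (fun k => s k = None)).
split=> -[u su ux].
  exists (fun k => u k.-1); first exact/(E (fun k => s k = Some (u k.-1))).
  by rewrite -(cvg_shiftS (fun k => u k.-1)).
exists (u \o succn); first exact/(E (fun k => s k = Some (u k))).
by rewrite (cvg_shiftS u).
Qed.

Lemma strong_cvg_hsucc s z : strong_cvg s z -> strong_cvg (hsucc \o s) (hsucc z).
Proof.
case: z => [x [u su ux]|sN] /=; last by apply: filterS sN => k ->.
exists (fun k => 1 + u k); first by apply: filterS su => k ->.
by apply: cvgD => //; exact: cvg_cst.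
Qed.

Lemma strong_cvg_hinv s z : z <> Some 0 -> strong_cvg s z ->
  strong_cvg (hinv \o s) (hinv z).
Proof.
case: z => [x x0 [u su ux]|_ sN] /=; last first.
  by exists (fun=> 0); [apply: filterS sN => k ->|exact: cvg_cst].
have {}x0 : x != 0 by apply/eqP => x0'; apply: x0; rewrite x0'.
rewrite (negbTE x0); exists (fun k => (u k)^-1); last exact: cvgV.
have u0 : \forall k \near \oo, u k != 0 by exact: (cvgr_neq0 x).
by near=> k => /=; rewrite (near su k) //= (negbTE (near u0 k _)).
Unshelve. all: by end_near. Qed.

(** * Convergence of continued fractions *)

Lemma cvg_cfrac n z : strong_cvg (fun k => cf_fin (mkseq n k)) z -> cfrac n = z.
Proof.
move=> /strong_cvg_cvg; apply: cvg_lim.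
exact/one_point_compactification_hausdorff/locally_compactR/Rhausdorff.
Qed.

Lemma cf_fin_mkseqS n k : cf_fin (mkseq n k.+1) =
  cf_step (n 0%N) (cf_fin (mkseq (n \o succn) k)) :> Rhat R.
Proof. by rewrite mkseqSl. Qed.

Definition hge0 z : Prop := if z is Some x then 0 <= x else True.

Lemma cf_fin_ge0 s : hge0 (cf_fin s).
Proof.
elim: s => //= -[m|] s //; case: (cf_fin s) => [x|] x0; rewrite /cf_step /=;
  last by rewrite addr0.
by case: (x == 0) => //=; rewrite addr_ge0 ?invr_ge0.
Qed.

Lemma strong_cvg_ge0 s z : (forall k, hge0 (s k)) -> strong_cvg s z -> hge0 z.
Proof.
case: z => //= x s0 [u su ux]; rewrite -(cvg_lim _ ux); last exact: Rhausdorff.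
apply: limr_ge; first exact: cvgP ux.
by apply: filterS su => k uk; have := s0 k; rewrite uk.
Qed.

Fixpoint cf_real (m : nat -> nat) k : R :=
  (m 0%N)%:R + (if k is k'.+1 then (cf_real (m \o succn) k')^-1 else 0).

Lemma cf_real_bounds m k : (forall i, 0 < m i.+1)%N ->
  (m 0%N)%:R <= cf_real m k <= (m 0%N)%:R + 1.
Proof.
elim: k m => [|k IH] m m0 /=; first by rewrite addr0 lexx lerDl ler01.
have /andP[lk _] := IH (m \o succn) (fun i => m0 i.+1).
have c1 : 1 <= cf_real (m \o succn) k by apply: le_trans lk; rewrite ler1n m0.
have c0 := lt_le_trans ltr01 c1.
by rewrite lerDl lerD2l invr_ge0 (ltW c0) invf_le1.
Qed.

(** Two steps of the fraction are the map y |-> m_0 + 1 / (m_1 + 1 / y), whose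
    difference quotient 1 / ((m_1 x + 1) (m_1 y + 1)) is at most 1 / 4 on
    [1, oo[. *)
Lemma cf_real_contract m j p q : (forall i, 0 < m i.+1)%N ->
  `|cf_real m (j.*2 + p) - cf_real m (j.*2 + q)| <= 4^-1 ^+ j.
Proof.
elim: j m => [|j IH] m m0.
  have /andP[lp up] := cf_real_bounds p m0.
  have /andP[lq uq] := cf_real_bounds q m0.
  by rewrite expr0 !add0n ler_norml; apply/andP; split; lra.
set m' := m \o succn \o succn.
have m'0 i : (0 < m' i.+1)%N by exact: m0.
have /andP[lx _] := cf_real_bounds (j.*2 + p) m'0.
have /andP[ly _] := cf_real_bounds (j.*2 + q) m'0.
have := IH _ m'0; rewrite doubleS !addSn /= -/m'.
move: lx ly; set x := cf_real m' _; set y := cf_real m' _ => lx ly.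
have m1 : 1 <= (m 1%N)%:R :> R by rewrite ler1n m0.
have m2 : 1 <= (m' 0%N)%:R :> R by rewrite ler1n; exact: m0.
have x1 : 1 <= x by exact: le_trans lx.
have y1 : 1 <= y by exact: le_trans ly.
move: m1; set c := (m 1%N)%:R => c1 xy.
have X : 2 <= c * x + 1 by nra.
have Y : 2 <= c * y + 1 by nra.
have -> : (m 0%N)%:R + (c + x^-1)^-1 - ((m 0%N)%:R + (c + y^-1)^-1) =
    (x - y) / ((c * x + 1) * (c * y + 1)).
  field; repeat (apply/andP; split); apply: lt0r_neq0; nra.
rewrite normrM normfV (@ger0_norm _ (_ * _)); last by nra.
rewrite exprSr; apply: ler_pM => //; first by rewrite invr_ge0; nra.
by rewrite lef_pV2 ?posrE; nra.
Qed.

Lemma cf_real_cvg m : (forall i, 0 < m i.+1)%N -> cvg (cf_real m @ \oo).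
Proof.
move=> m0; apply/cauchy_cvgP/cauchy_exP => e e0.
have [j je] : exists j, 4^-1 ^+ j < e :> R.
  have : (fun j => 4^-1 ^+ j : R) @ \oo --> 0.
    by apply: cvg_expr; rewrite ger0_norm; lra.
  move=> /cvgr_lt /(_ _ e0) [j _ /(_ j (leqnn j))]; by exists j.
exists (cf_real m j.*2); exists j.*2 => // k /= jk.
rewrite -ball_normE /=; apply: le_lt_trans je.
by have := @cf_real_contract m j 0 (k - j.*2) m0; rewrite addn0 subnKC.
Qed.

Lemma cf_fin_real m k : (forall i, 0 < m i.+1)%N ->
  cf_fin (mkseq (Some \o m) k.+1) = Some (cf_real m k) :> Rhat R.
Proof.
elim: k m => [|k IH] m m0; rewrite cf_fin_mkseqS //.
have m'0 i : (0 < (m \o succn) i.+1)%N by exact: m0.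
rewrite -[_ \o succn]/(Some \o (m \o succn)) IH // /cf_step /= gt_eqF //.
have /andP[lk _] := cf_real_bounds k m'0.
by apply: lt_le_trans lk; rewrite ltr0n m0.
Qed.

Lemma cf_fin_stationary n i : n i = None ->
  exists z : Rhat R, forall k, (i < k)%N -> cf_fin (mkseq n k) = z.
Proof.
elim: i n => [|i IH] n ni.
  by exists None => -[|k] // _; rewrite cf_fin_mkseqS ni.
have [z zE] := IH (n \o succn) ni.
by exists (cf_step (n 0%N) z) => -[|k] // ik; rewrite cf_fin_mkseqS zE.
Qed.

(** Without an infinite exponent the convergents form a real Cauchy sequence; an
    infinite exponent makes them stationary.  The 0-th convergent is the empty
    fraction oo, so the real sequence starts at index 1. *)
Lemma cfrac_cvg n : (forall i, n i.+1 <> Some 0%N) ->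
  strong_cvg (fun k => cf_fin (mkseq n k)) (cfrac n).
Proof.
move=> n0; suff [z zP] : exists z, strong_cvg (fun k => cf_fin (mkseq n k)) z.
  by rewrite (cvg_cfrac zP).
have [[i /cf_fin_stationary[z zE]]|nN] := pselect (exists i, n i = None).
  by exists z; apply: strong_cvg_cst; exists i.+1.
pose m i := odflt 0%N (n i).
have nE : n = Some \o m.
  by apply/funext => i; rewrite /m /=; case E: (n i) => //; case: nN; exists i.
have m0 i : (0 < m i.+1)%N by have := n0 i; rewrite nE /=; case: (m i.+1).
exists (Some (lim (cf_real m @ \oo))); apply/strong_cvg_shift.
exists (cf_real m); last exact: cf_real_cvg.
by apply: nearW => k; rewrite nE; exact: cf_fin_real.
Qed.

Lemma cfrac_ge0 n : (forall i, n i.+1 <> Some 0%N) -> hge0 (cfrac n).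
Proof.
by move=> /cfrac_cvg; apply: strong_cvg_ge0 => k; exact: cf_fin_ge0.
Qed.

End RealLine.

(** * Exponents of a digit sequence *)

Lemma run_eq0 b a : a 0%N = ~~ b -> run b a = Some 0%N.
Proof.
move=> a0; rewrite /run; case: pselect => [ex|[]]; last first.
  by exists 0%N; rewrite a0; case: b {a0}.
by case: ex_minnP => [[|m]] // _ /(_ 0%N); rewrite a0 ltn0;
  case: b {a0 ex} => /(_ isT).
Qed.

Lemma runS b a : a 0%N = b -> run b a = omap succn (run b (a \o succn)).
Proof.
move=> a0; rewrite /run.
case: pselect => [ex|nex]; case: pselect => [ex'|nex'] //=.
- congr Some; case: ex_minnP => m am m_min; case: ex_minnP => m' am' m'_min.
  case: m am m_min => [|m] => [|am m_min]; first by rewrite a0 eqxx.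
  by apply/eqP; rewrite eqSS eqn_leq m'_min //= -ltnS m_min.
- by have [[|i]] := ex; [rewrite a0 eqxx|move=> ai; case: nex'; exists i].
- by case: nex; case: ex' => i ai; exists i.+1.
Qed.

Lemma run_neg b a : run b (negb \o a) = run (~~ b) a.
Proof.
pose first (P : pred nat) : option nat :=
  if pselect (exists i, P i) is left ex then Some (ex_minn ex) else None.
rewrite -[LHS]/(first (fun i => (negb \o a) i != b)).
rewrite -[RHS]/(first (fun i => a i != ~~ b)).
by congr first; apply/funext => i /=; case: (a i) b => -[].
Qed.

Lemma exponent0 b a : exponent b a 0 = run b a.
Proof. by rewrite /=; case: run. Qed.

Lemma exponent_neg b a i : exponent b (negb \o a) i = exponent (~~ b) a i.
Proof.
elim: i b a => [|i IH] b a; first by rewrite !exponent0 run_neg.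
by rewrite /= run_neg; case: run => [n|] //; exact: (IH (~~ b)).
Qed.

Lemma run_stop b a n : run b a = Some n -> a n = ~~ b.
Proof.
rewrite /run; case: pselect => // ex [<-]; case: ex_minnP => m am _.
by case: (a m) b am {ex} => -[].
Qed.

Lemma exponent_recl b a i : exponent b a i.+1 =
  if run b a is Some n then exponent (~~ b) (fun j => a (n + j)%N) i else None.
Proof. by []. Qed.

Lemma exponent_neq0 b a i : exponent b a i.+1 <> Some 0%N.
Proof.
elim: i b a => [|i IH] b a; rewrite exponent_recl; last first.
  by case: run => [n|] //; exact: IH.
case r: run => [n|] //; rewrite exponent0 runS; first by case: run.
by rewrite addn0 (run_stop r).
Qed.

Lemma exponentS b a i : a 0%N = b ->
  exponent b a i.+1 = exponent b (a \o succn) i.+1.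
Proof. by move=> a0 /=; rewrite (runS a0); case: run. Qed.

Lemma exponent_start b a i : a 0%N = ~~ b ->
  exponent b a i.+1 = exponent (~~ b) a i.
Proof. by move=> a0 /=; rewrite run_eq0. Qed.

(** * Action of the digits on values *)

Section Digits.
Context {R : realType}.
Implicit Types (x y : R) (z : Rhat R) (a : nat -> bool) (b : bool).

Local Notation cf b a := (cfrac (exponent b a) : Rhat R).

Lemma hoppK : involutive (@hopp R).
Proof. by case=> [x|] //=; rewrite opprK. Qed.

Lemma hinvK : involutive (@hinv R).
Proof.
case=> [x|] /=; last by rewrite eqxx.
have [->|x0] := eqVneq x 0; first by [].
by rewrite /= invr_eq0 (negbTE x0) invrK.
Qed.

Lemma hinv_hopp z : hinv (hopp z) = hopp (hinv z).
Proof.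
case: z => [x|] /=; last by rewrite oppr0.
by rewrite oppr_eq0; case: (x == 0) => //=; rewrite invrN.
Qed.

(** A further initial b increases the first exponent by 1. *)
Lemma cfrac_exponentS b a : a 0%N = b -> cf b a = hsucc (cf b (a \o succn)).
Proof.
move=> a0; apply: cvg_cfrac; apply/strong_cvg_shift.
have := strong_cvg_hsucc ((strong_cvg_shift _ _).2
  (cfrac_cvg (R := R) (@exponent_neq0 b (a \o succn)))).
congr strong_cvg; apply/funext => k.
rewrite -[LHS]/(hsucc (cf_fin (mkseq (exponent b (a \o succn)) k.+1))).
rewrite -[RHS]/(cf_fin (mkseq (exponent b a) k.+1)) !cf_fin_mkseqS.
rewrite !exponent0 (runS a0).
have -> : exponent b (a \o succn) \o succn = exponent b a \o succn.
  by apply/funext => i; rewrite /comp (exponentS _ a0).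
case: run => [n|] //; case: cf_fin => [x|]; rewrite /cf_step /= -?natr1.
  by case: (x == 0) => //=; rewrite addrCA addrA [_ + 1]addrC.
by rewrite !addr0 addrC.
Qed.

Lemma cfrac_exponent_ge0 b a : hge0 (cf b a).
Proof. exact/cfrac_ge0/exponent_neq0. Qed.

(** When a does not start with b its first exponent is 0, and the other ones are
    the exponents of a counted from ~~ b.  The inverse is continuous at the
    value of the latter fraction, which is at least 1. *)
Lemma cfrac_exponent_start b a : a 0%N = ~~ b -> cf b a = hinv (cf (~~ b) a).
Proof.
move=> a0; apply: cvg_cfrac; apply/strong_cvg_shift.
have nz : cf (~~ b) a <> Some 0.
  rewrite (cfrac_exponentS a0); have := cfrac_exponent_ge0 (~~ b) (a \o succn).
  by case: cfrac => //= x x0 [] /eqP; rewrite gt_eqF // ltr_wpDr.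
have := strong_cvg_hinv nz (cfrac_cvg (R := R) (@exponent_neq0 (~~ b) a)).
congr strong_cvg; apply/funext => k.
rewrite -[LHS]/(hinv (cf_fin (mkseq (exponent (~~ b) a) k))).
rewrite -[RHS]/(cf_fin (mkseq (exponent b a) k.+1)) cf_fin_mkseqS.
rewrite exponent0 (run_eq0 a0).
have -> : exponent b a \o succn = exponent (~~ b) a.
  by apply/funext => i; rewrite /comp (exponent_start _ a0).
by rewrite /cf_step; case: hinv => // x; rewrite add0r.
Qed.

(** One of b and ~~ b is not the first digit, and inversion is an
    involution. *)
Lemma cfrac_exponent_neg b a : cf (~~ b) a = hinv (cf b a).
Proof.
have [a0|a0] : a 0%N = ~~ b \/ a 0%N = ~~ ~~ b.
- by case: (a 0%N) b => -[]; [right|left|left|right].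
- by rewrite (cfrac_exponent_start a0) hinvK.
- by rewrite (cfrac_exponent_start a0) negbK.
Qed.

Lemma kappa_U w : kappa (U_bd w) = hinv (kappa w) :> Rhat R.
Proof.
rewrite /kappa /U_bd; case: w => s a /=.
have -> : exponent false (fun i => ~~ a i) = exponent true a.
  by apply/funext => i; rewrite (exponent_neg false a).
by rewrite (cfrac_exponent_neg false); case: s => //; rewrite hinv_hopp.
Qed.

Lemma cfrac_digit a : cf false a =
  if a 0%N then hinv (hsucc (hinv (cf false (a \o succn))))
  else hsucc (cf false (a \o succn)).
Proof.
case a0: (a 0%N); last by rewrite (cfrac_exponentS a0).
rewrite cfrac_exponent_start // (cfrac_exponentS a0).
by rewrite (cfrac_exponent_neg false).
Qed.

(** * Irrational numbers and the Farey map *)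

Lemma irrationalV x : irrational x -> irrational x^-1.
Proof.
move=> xI [q _ qx]; apply: xI; exists q^-1 => //.
by rewrite fmorphV /= qx invrK.
Qed.
Lemma irrationalN x : irrational x -> irrational (- x).
Proof.
move=> xI [q _ qx]; apply: xI; exists (- q) => //.
by rewrite rmorphN /= qx opprK.
Qed.
Lemma irrationalB1 x : irrational x -> irrational (x - 1).
Proof.
move=> xI [q _ qx]; apply: xI; exists (q + 1) => //.
by rewrite rmorphD rmorph1 /= qx subrK.
Qed.
Lemma irrational_neq0 x : irrational x -> x != 0.
Proof. by move=> xI; apply/eqP => x0; apply: xI; exists 0; rewrite ?rmorph0. Qed.
Lemma irrational_neq1 x : irrational x -> x != 1.
Proof. by move=> xI; apply/eqP => x0; apply: xI; exists 1; rewrite ?rmorph1. Qed.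

(** The first branch is x / (1 - x), written so as to be the inverse of
    y |-> 1 / (1 + 1 / y) step by step. *)
Definition farey x : R := if x < 1 then (x^-1 - 1)^-1 else x - 1.
Definition farey_digits x (i : nat) : bool := iter i farey x < 1.

Lemma farey_digitsS x : farey_digits x \o succn = farey_digits (farey x).
Proof. by apply/funext => i; rewrite /farey_digits /= -iterSr. Qed.

Lemma farey_irrational x : irrational x -> irrational (farey x).
Proof.
rewrite /farey; case: ifP => _ xI; last exact: irrationalB1.
exact/irrationalV/irrationalB1/irrationalV.
Qed.

Lemma farey_gt0 x : irrational x -> 0 < x -> 0 < farey x.
Proof.
move=> xI x0; rewrite /farey; case: (ltP x 1) => x1.
  by rewrite invr_gt0 subr_gt0 invf_gt1.
by rewrite subr_gt0 lt_neqAle eq_sym irrational_neq1.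
Qed.

(** The two possible first digits overlap only in the value 1, which belongs to
    both 0 1 1 1 ... and 1 0 0 0 ... *)
Lemma cfrac_first_digit a x : irrational x -> cf false a = Some x ->
  a 0%N = (x < 1) /\ cf false (a \o succn) = Some (farey x).
Proof.
move=> xI; rewrite cfrac_digit; have := cfrac_exponent_ge0 false (a \o succn).
case: cfrac => [y|] /=; case: (a 0%N) => //.
- have [->|yn0] := eqVneq y 0.
    by move=> _ [/esym /eqP]; rewrite (negbTE (irrational_neq0 xI)).
  move=> yge; have {yge} y0 : 0 < y by rewrite lt_def yn0.
  rewrite /= gt_eqF ?addr_gt0 ?invr_gt0 // => -[<-]; rewrite /farey.
  have y1 : 1 < 1 + y^-1 by rewrite ltrDl invr_gt0.
  by rewrite invf_lt1 ?(lt_trans ltr01) // y1 invrK addrC addKr invrK.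
- move=> y0 [<-]; rewrite /farey ltNge lerDl y0 /=; split=> //.
  by rewrite addrC addKr.
- rewrite addr0 oner_eq0 invr1 => _ [] /eqP.
  by rewrite eq_sym (negbTE (irrational_neq1 xI)).
Qed.

Lemma cfrac_digits a x : irrational x -> cf false a = Some x ->
  a = farey_digits x.
Proof.
move=> xI ax; apply/funext => i; elim: i a x xI ax => [|i IH] a x xI ax.
  by have [] := cfrac_first_digit xI ax.
have [_ /(IH _ _ (farey_irrational xI)) /= ->] := cfrac_first_digit xI ax.
by rewrite -farey_digitsS.
Qed.

(** Infinite descent on p + q.  The inequalities are cleared of the
    denominator q, and the value of the word may be infinite. *)
Lemma farey_no_fraction_between x (p q : nat) : irrational x -> 0 < x ->
  (0 < p)%N -> (0 < q)%N ->
  ~ (x * q%:R < p%:R /\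
     if cf false (farey_digits x) is Some y then p%:R < y * q%:R else True) /\
  ~ (p%:R < x * q%:R /\
     if cf false (farey_digits x) is Some y then y * q%:R < p%:R else False).
Proof.
have [N] := ubnP (p + q); elim: N x p q => // N IH x p q pqN xI x0 p0 q0.
have {}IH p' q' : (p' + q' < p + q)%N -> (0 < p')%N -> (0 < q')%N -> _ :=
  fun lt p'0 q'0 => IH (farey x) p' q' (leq_trans lt pqN)
    (farey_irrational xI) (farey_gt0 xI x0) p'0 q'0.
have [p0R q0R] : 0 < p%:R :> R /\ 0 < q%:R :> R by rewrite !ltr0n.
rewrite cfrac_digit farey_digitsS -[farey_digits x 0]/(x < 1).
have := cfrac_exponent_ge0 false (farey_digits (farey x)).
case: (ltP x 1) => x1.
  have xq : x * q%:R < q%:R by rewrite gtr_pMl.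
  have xE : farey x * (1 - x) = x.
    by rewrite /farey x1; field; rewrite ?subr_eq0; apply/andP; split; lra.
  (* The word has a value <= 1, so that a fraction p / q >= 1 is excluded. *)
  have [pq|qp] := ltnP p q; last first.
    have qpR : q%:R <= p%:R :> R by rewrite ler_nat.
    case: cfrac => [y|] /= y0; last first.
      by rewrite addr0 oner_eq0 invr1 /=; split=> -[h1 h2]; lra.
    have [_|yn0] /= := eqVneq y 0; first by split=> -[h1 h2]; lra.
    have {yn0}y0 : 0 < y by rewrite lt_def yn0.
    rewrite /= gt_eqF ?addr_gt0 ?invr_gt0 //.
    have yq : (1 + y^-1)^-1 * q%:R < q%:R.
      by rewrite gtr_pMl // invf_lt1 ?ltrDl ?addr_gt0 ?invr_gt0.
    by split=> -[h1 h2]; lra.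
  have [] := IH p (q - p)%N; [lia|lia|lia|].
  rewrite natrB ?(ltnW pq) //.
  (* t |-> t / (1 - t) is increasing on [0, 1[ and maps p / q to
     p / (q - p). *)
  have xpq : (x * q%:R < p%:R) = (farey x * (q%:R - p%:R) < p%:R).
    by rewrite -{1}xE; apply/idP/idP => h; nra.
  have xpq' : (p%:R < x * q%:R) = (p%:R < farey x * (q%:R - p%:R)).
    by rewrite -{1}xE; apply/idP/idP => h; nra.
  have pqR : p%:R < q%:R :> R by rewrite ltr_nat.
  rewrite xpq xpq'; case: cfrac => [y|] /= IHl IHr y0; last first.
    rewrite addr0 oner_eq0 invr1 /= mul1r; split=> -[h1 h2]; last lra.
    exact: IHl.
  have [y00|yn0] /= := eqVneq y 0.
    split=> -[h1 h2]; first lra.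
    by apply: IHr; rewrite y00 mul0r.
  have {yn0}y0 : 0 < y by rewrite lt_def yn0.
  rewrite /= gt_eqF ?addr_gt0 ?invr_gt0 //.
  have -> : (1 + y^-1)^-1 = y / (1 + y) by field; apply/andP; split; lra.
  rewrite mulrAC ltr_pdivlMr ?ltr_pdivrMr; [|lra|lra].
  by split=> -[h1 h2]; [apply: IHl|apply: IHr]; split=> //; lra.
have xq : q%:R <= x * q%:R by rewrite ler_pMl.
have xE : farey x = x - 1 by rewrite /farey ltNge x1.
(* Here the word has a value >= 1, so that p / q <= 1 is excluded. *)
have [qp|pq] := ltnP q p; last first.
  have pqR : p%:R <= q%:R :> R by rewrite ler_nat.
  case: cfrac => [y|] //= y0; last by split=> -[h1 h2]; lra.
  have yq : 0 <= y * q%:R by rewrite mulr_ge0 // ltW.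
  by split=> -[h1 h2]; lra.
have [] := IH (p - q)%N q; [lia|lia|lia|].
rewrite natrB ?(ltnW qp) // xE; case: cfrac => [y|] /= IHl IHr y0.
  by split=> -[h1 h2]; [apply: IHl|apply: IHr]; split; lra.
by split=> -[h1 h2] //; apply: IHl; split=> //; lra.
Qed.

Lemma fraction_between x y : 0 <= x < y ->
  exists p q : nat,
    [/\ (0 < p)%N, (0 < q)%N, x * q%:R < p%:R & p%:R < y * q%:R].
Proof.
case/andP => x0 /rat_in_itvoo[r]; rewrite in_itv /= => /andP[xr ry].
have /rationalP[n [q rE]] : rational (ratr r : R) by exists r.
have r0 := le_lt_trans x0 xr.
have q0 : (0 < q)%N.
  by case: q rE => // rE; move: r0; rewrite rE invr0 mulr0 ltxx.
have qR : 0 < q%:R :> R by rewrite ltr0n.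
case: n rE => [p|p] rE; last first.
  by move: r0; rewrite rE NegzE mulrNz mulNr oppr_gt0 ltNge divr_ge0.
move: xr ry r0; rewrite rE -pmulrn ltr_pdivlMr // ltr_pdivrMr // => xp py.
by rewrite ltr_pdivlMr // mul0r ltr0n => p0; exists p, q; split.
Qed.

(** The density of the fractions, against [farey_no_fraction_between]. *)
Lemma cfrac_farey_digits x : irrational x -> 0 < x ->
  cf false (farey_digits x) = Some x.
Proof.
move=> xI x0.
have NF p q p0 q0 := @farey_no_fraction_between x p q xI x0 p0 q0.
have := cfrac_exponent_ge0 false (farey_digits x).
case: cfrac NF => [y|] NF /= y0.
  congr Some; case: (ltgtP x y) => // [xy|yx].
    have /fraction_between[p [q [p0 q0 xp py]]] : 0 <= x < y by rewrite ltW.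
    by case: (NF p q p0 q0) => /(_ (conj xp py)).
  have /fraction_between[p [q [p0 q0 yp px]]] : 0 <= y < x by rewrite y0.
  by case: (NF p q p0 q0) => _ /(_ (conj px yp)).
have /fraction_between[p [q [p0 q0 xp _]]] : 0 <= x < x + 1.
  by rewrite ltW //= ltrDl.
by case: (NF p q p0 q0) => /(_ (conj xp I)).
Qed.

(** The values of words that do not start with S are nonnegative or infinite, so
    the sign of x decides the first letter. *)
Lemma kappaP w x : irrational x -> kappa w = Some x <->
  w = (x < 0, farey_digits (if x < 0 then - x^-1 else x)).
Proof.
move=> xI; have xn0 := irrational_neq0 xI.
have yI := irrationalN (irrationalV xI).
case: w => s a; rewrite /kappa /=; split.
  have := cfrac_exponent_ge0 false a; case: s => c0 E.
    have {}E : cf false a = Some (- x^-1).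
      have := congr1 (fun z => hinv (hopp z)) E; rewrite hoppK hinvK => ->.
      by rewrite /= oppr_eq0 (negbTE xn0) invrN.
    have xneg : x < 0 by move: c0; rewrite E /= oppr_ge0 invr_le0 lt_neqAle xn0.
    by rewrite xneg; congr pair; apply: cfrac_digits.
  have xge : 0 <= x by move: c0; rewrite E.
  by rewrite ltNge xge; congr pair; apply: cfrac_digits.
case: ltP => x0 [-> ->]; last first.
  by apply: cfrac_farey_digits => //; rewrite lt_def xn0.
rewrite cfrac_farey_digits ?oppr_gt0 ?invr_lt0 //=.
by rewrite oppr_eq0 invr_eq0 (negbTE xn0) /= invrN invrK opprK.
Qed.

Lemma kappa_bd_of x : irrational x -> kappa (bd_of x) = Some x.
Proof.
move=> xI; apply: (@getPex _ [set w | kappa w = Some x]).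
by eexists; apply/kappaP.
Qed.

Lemma bd_of_V x : irrational x -> bd_of x^-1 = U_bd (bd_of x).
Proof.
move=> xI; have xV := irrationalV xI.
have kU : kappa (U_bd (bd_of x)) = Some x^-1.
  by rewrite kappa_U kappa_bd_of //= (negbTE (irrational_neq0 xI)).
by rewrite ((kappaP _ xV).1 kU); exact/kappaP/kappa_bd_of.
Qed.

End Digits.

Theorem lemma9 (R : realType) :
  [/\ aut_comp J_F U_F = aut_comp U_F J_F,
      forall w : boundary, J_bd (U_bd w) = U_bd (J_bd w)
    & forall x : R, irrational x -> J_R x^-1 = hinv (J_R x) ].
Proof.
split=> [|w|x xI]; [exact: J_U_F|exact: J_U_bd|].
by rewrite /J_R bd_of_V // J_U_bd kappa_U.
Qed.
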